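(* Fix a theory $\Sigma$ of directed first-order logic and polarized contexts. For all contexts $\Theta,\Delta,\Gamma$, let $\Delta_1,\Delta_2$ be two disjoint copies of $\Delta$ (fresh variable names). The map \[ \{[\Theta,\Delta_1 \mid \bullet \mid \Gamma,\Delta_2]\ \varphi\ \mathsf{prop}\} \longrightarrow \{[\Theta \mid \Delta \mid \Gamma]\ \varphi\ \mathsf{prop}\} \] which sends a formula to the formula obtained by replacing every variable of $\Delta_1$ and every variable of $\Delta_2$ by the corresponding variable of $\Delta$ (the full dinatural collapse) is well defined and is a bijection. In particular there is a bijection $\{[\Theta\mid\Delta\mid\Gamma]\ \varphi\ \mathsf{prop}\} \cong \{[\Theta,\Delta \mid \bullet \mid \Gamma,\Delta]\ \varphi\ \mathsf{prop}\}$, i.e. the syntactic doctrine $\mathsf{Syn}(\Sigma)$ satisfies the no-dinatural-variance condition.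
   Context: A theory provides: a set $\Sigma_B$ of base types; types are generated by base types, $\top$, $A\times B$, $A\Rightarrow B$; contexts are finite lists of typed variables, $\bullet$ is the empty context, and $\Theta,\Delta$ denotes concatenation. A set $\Sigma_F$ of function symbols with types $\mathsf{dom}(f),\mathsf{cod}(f)$; terms $\Gamma \vdash t : A$ are those of the simply typed $\lambda$-calculus with unit, products and functions (variables, $f(t)$ for $\Gamma\vdash t:\mathsf{dom}(f)$, $!$, pairs, projections, application, $\lambda$-abstraction). A set $\Sigma_P$ of predicate symbols with types $\mathsf{neg}(P),\mathsf{pos}(P)$. A polarized context is a triple $[\Theta\mid\Delta\mid\Gamma]$ of contexts (negative, dinatural, positive variables). For a polarity $p\in\{-,\Delta,+\}$, $[\Theta\mid\Delta\mid\Gamma],[x:^pA]$ denotes the polarized context with $x:A$ appended to $\Theta$, $\Delta$ or $\Gamma$ respectively. Formulas $[\Theta\mid\Delta\mid\Gamma]\ \varphi\ \mathsf{prop}$ are the syntax trees (up to renaming of bound variables) generated by: $\top$ in any polarized context; $\psi\wedge\varphi$ from $[\Theta\mid\Delta\mid\Gamma]\ \psi$ and $[\Theta\mid\Delta\mid\Gamma]\ \varphi$; $\psi\Rightarrow\varphi$ in $[\Theta\mid\Delta\mid\Gamma]$ from $[\Gamma\mid\Delta\mid\Theta]\ \psi$ (negative and positive contexts swapped) and $[\Theta\mid\Delta\mid\Gamma]\ \varphi$; $s\le_A t$ from terms $\Theta,\Delta\vdash s:A$ and $\Gamma,\Delta\vdash t:A$; $P(s\mid t)$ for $P\in\Sigma_P$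 from $\Theta,\Delta\vdash s:\mathsf{neg}(P)$ and $\Gamma,\Delta\vdash t:\mathsf{pos}(P)$; and $\exists^p x.\varphi$, $\forall^p x.\varphi$ in $[\Theta\mid\Delta\mid\Gamma]$ from $[\Theta\mid\Delta\mid\Gamma],[x:^pA]\ \varphi$, for $p\in\{-,\Delta,+\}$. The renaming map in the claim acts on the subformulas of an implication's left side with the roles of the negative and positive contexts swapped accordingly. *)

(* Defs.v *)
From Stdlib Require List.
From mathcomp Require Import all_boot.
From mathcomp Require Import boolp classical_sets functions.

Set Implicit Arguments.
Unset Strict Implicit.
Unset Printing Implicit Defensive.

Inductive ty (B : Type) : Type :=
| TBase of B
| TUnit
| TProd of ty B & ty B
| TArr of ty B & ty B.
Arguments TUnit {B}.

Record theory := Theory {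
  base : Type;
  fsym : Type;
  fdom : fsym -> ty base;
  fcod : fsym -> ty base;
  psym : Type;
  pneg : psym -> ty base;
  ppos : psym -> ty base }.

Notation typ S := (ty (base S)).

(* Syntax trees up to renaming of bound variables: the free variables of a tree
   of type [tm S V] or [fm S V] are names in [V]; below a binder the names are
   [option V], where [None] is the bound variable. *)
Inductive tm (S : theory) (V : Type) : Type :=
| TmVar of V
| TmFun (f : fsym S) of tm S V
| TmBang
| TmPair of tm S V & tm S V
| TmFst of tm S V
| TmSnd of tm S V
| TmApp of tm S V & tm S V
| TmLam of typ S & tm S (option V).
Arguments TmVar {S V} _.
Arguments TmBang {S V}.

Inductive polarity := Neg | Din | Pos.

Inductive fm (S : theory) (V : Type) : Type :=
| FmTop
| FmAnd of fm S V & fm S V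
| FmImp of fm S V & fm S V
| FmLe of typ S & tm S V & tm S V
| FmPred (P : psym S) of tm S V & tm S V
| FmEx of polarity & typ S & fm S (option V)
| FmAll of polarity & typ S & fm S (option V).
Arguments FmTop {S V}.

Fixpoint tm_map (S : theory) (V W : Type) (h : V -> W) (t : tm S V) : tm S W :=
  match t with
  | TmVar x => TmVar (h x)
  | TmFun f t => TmFun f (tm_map h t)
  | TmBang => TmBang
  | TmPair t u => TmPair (tm_map h t) (tm_map h u)
  | TmFst t => TmFst (tm_map h t)
  | TmSnd t => TmSnd (tm_map h t)
  | TmApp t u => TmApp (tm_map h t) (tm_map h u)
  | TmLam A t => TmLam A (tm_map (omap h) t)
  end.

Fixpoint fm_map (S : theory) (V W : Type) (h : V -> W) (phi : fm S V) : fm S W :=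
  match phi with
  | FmTop => FmTop
  | FmAnd psi phi => FmAnd (fm_map h psi) (fm_map h phi)
  | FmImp psi phi => FmImp (fm_map h psi) (fm_map h phi)
  | FmLe A s t => FmLe A (tm_map h s) (tm_map h t)
  | FmPred P s t => FmPred P (tm_map h s) (tm_map h t)
  | FmEx p A phi => FmEx p A (fm_map (omap h) phi)
  | FmAll p A phi => FmAll p A (fm_map (omap h) phi)
  end.

Definition ctx (S : theory) (V : Type) := seq (V * typ S).

Definition names (S : theory) (V : Type) (G : ctx S V) : seq V := unzip1 G.

Definition ctx_shift (S : theory) (V : Type) (G : ctx S V) : ctx S (option V) :=
  [seq (Some xA.1, xA.2) | xA <- G].

Definition ctx_ext (S : theory) (V : Type) (G : ctx S V) (A : typ S) :
    ctx S (option V) :=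
  rcons (ctx_shift G) (None, A).

Inductive has_type (S : theory) (V : Type) (G : ctx S V) :
    tm S V -> typ S -> Prop :=
| HVar x A : List.In (x, A) G -> has_type G (TmVar x) A
| HFun f t : has_type G t (fdom f) -> has_type G (TmFun f t) (fcod f)
| HBang : has_type G TmBang TUnit
| HPair t u A B : has_type G t A -> has_type G u B ->
    has_type G (TmPair t u) (TProd A B)
| HFst t A B : has_type G t (TProd A B) -> has_type G (TmFst t) A
| HSnd t A B : has_type G t (TProd A B) -> has_type G (TmSnd t) B
| HApp t u A B : has_type G t (TArr A B) -> has_type G u A ->
    has_type G (TmApp t u) B
| HLam t A B : has_type (ctx_ext G A) t B -> has_type G (TmLam A t) (TArr A B).

Record pctx (S : theory) (V : Type) :=
  PCtx { negc : ctx S V; dinc : ctx S V; posc : ctx S V }.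

Notation "[ctx Th | De | Ga ]" := (PCtx Th De Ga)
  (at level 0, Th, De, Ga at level 99, format "[ctx  Th  |  De  |  Ga ]").

Definition pctx_swap (S : theory) (V : Type) (C : pctx S V) : pctx S V :=
  [ctx posc C | dinc C | negc C].

Definition pctx_ext (S : theory) (V : Type) (C : pctx S V) (p : polarity)
    (A : typ S) : pctx S (option V) :=
  let: PCtx Th De Ga := C in
  match p with
  | Neg => [ctx ctx_ext Th A | ctx_shift De | ctx_shift Ga]
  | Din => [ctx ctx_shift Th | ctx_ext De A | ctx_shift Ga]
  | Pos => [ctx ctx_shift Th | ctx_shift De | ctx_ext Ga A]
  end.

Inductive is_prop (S : theory) (V : Type) (C : pctx S V) : fm S V -> Prop :=
| PTop : is_prop C FmTop
| PAnd psi phi : is_prop C psi -> is_prop C phi -> is_prop C (FmAnd psi phi)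
| PImp psi phi : is_prop (pctx_swap C) psi -> is_prop C phi ->
    is_prop C (FmImp psi phi)
| PLe A s t : has_type (negc C ++ dinc C) s A ->
    has_type (posc C ++ dinc C) t A -> is_prop C (FmLe A s t)
| PPred P s t : has_type (negc C ++ dinc C) s (pneg P) ->
    has_type (posc C ++ dinc C) t (ppos P) -> is_prop C (FmPred P s t)
| PEx p A phi : is_prop (pctx_ext C p A) phi -> is_prop C (FmEx p A phi)
| PAll p A phi : is_prop (pctx_ext C p A) phi -> is_prop C (FmAll p A phi).

Definition formulas (S : theory) (V : Type) (C : pctx S V) : set (fm S V) :=
  [set phi | is_prop C phi]%classic.

(* Terms only ever see Th ++ De or Ga ++ De, so these are the two lists whose
   names must be distinct.  A name may occur both in Th and in Ga; it then
   denotes two different variables, told apart by the side of an atom on which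
   they occur.  The polarized context [Th, De | nil | Ga, De] relies on this. *)
Definition wf_pctx (S : theory) (V : eqType) (C : pctx S V) : bool :=
  uniq (names (negc C ++ dinc C)) && uniq (names (posc C ++ dinc C)).

Definition fresh_copies (S : theory) (V : eqType) (Th De Ga D1 D2 : ctx S V) :
    Prop :=
  [/\ unzip2 D1 = unzip2 De,
      unzip2 D2 = unzip2 De,
      uniq (names D1 ++ names D2) &
      ~~ has (mem (names Th ++ names De ++ names Ga)) (names D1 ++ names D2)].

(* The i-th name of D1, and likewise of D2, goes to the i-th name of De; all
   other names are fixed. *)
Definition collapse_name (S : theory) (V : eqType) (D1 D2 De : ctx S V) (x : V) :
    V :=
  if x \in names D1 then nth x (names De) (index x (names D1))
  else if x \in names D2 then nth x (names De) (index x (names D2))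
  else x.

Definition collapse (S : theory) (V : eqType) (D1 D2 De : ctx S V) :
    fm S V -> fm S V :=
  fm_map (collapse_name D1 D2 De).

(* Main.v *)
Require Import Defs.
From mathcomp Require Import all_boot.
From mathcomp Require Import boolp classical_sets functions.

Set Implicit Arguments.
Unset Strict Implicit.
Unset Printing Implicit Defensive.

(** An atom only sees the lists [Th ++ De] (left) and [Ga ++ De] (right), so
    well-formedness depends only on the sets of declarations in these two lists;
    swapping and extending a polarized context act on the two lists separately.
    Hence a renaming that is a bijection between the left lists and between the
    right lists of two polarized contexts is a bijection on formulas, even if it
    identifies a left name with a right name. The collapse is such a renaming,
    and the no-dinatural-variance bijection is the identity. *)

(** * Renamings of declaration lists, and their passage under a binder *)

Definition ctx_image (S : theory) (V W : Type) (h : V -> W)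
    (G : ctx S V) (H : ctx S W) : Prop :=
  forall y A, List.In (y, A) H <-> exists2 x, h x = y & List.In (x, A) G.

(** Only names declared in [G] are compared, and their types may differ: equal images of two names
    must force equality before any types are known to agree. *)
Definition ctx_inj (S : theory) (V W : Type) (h : V -> W) (G : ctx S V) : Prop :=
  forall x y A B, List.In (x, A) G -> List.In (y, B) G -> h x = h y -> x = y.

Lemma in_ctx_shift (S : theory) (V : Type) (G : ctx S V) z B :
  List.In (z, B) (ctx_shift G) <-> exists2 x, z = Some x & List.In (x, B) G.
Proof.
elim: G => [|[x A] G IH] /=; first by split=> // -[].
split=> [[[<- <-]|/IH[y -> yG]]|[y zE [[-> ->]|yG]]].
- by exists x => //; left.
- by exists y => //; right.
- by left; rewrite zE.
- by right; apply/IH; exists y.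
Qed.

Lemma in_ctx_ext (S : theory) (V : Type) (G : ctx S V) A z B :
  List.In (z, B) (ctx_ext G A) <->
  (z, B) = (None, A) \/ List.In (z, B) (ctx_shift G).
Proof.
rewrite /ctx_ext -cats1; split=> [/(@List.in_app_or _ _ _ _)[|[|[]]]|[->|]].
- by right.
- by left.
- by apply: List.in_or_app; right; left.
- by move=> zG; apply: List.in_or_app; left.
Qed.

Lemma ctx_image_shift (S : theory) (V W : Type) (h : V -> W) (G : ctx S V) H :
  ctx_image h G H -> ctx_image (omap h) (ctx_shift G) (ctx_shift H).
Proof.
move=> hGH z B; split.
  case/in_ctx_shift=> y -> /hGH[x <- xG].
  by exists (Some x) => //; apply/in_ctx_shift; exists x.
case=> _ <- /in_ctx_shift[x -> xG]; apply/in_ctx_shift.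
by exists (h x) => //; apply/hGH; exists x.
Qed.

Lemma ctx_image_ext (S : theory) (V W : Type) (h : V -> W) (G : ctx S V) H A :
  ctx_image h G H -> ctx_image (omap h) (ctx_ext G A) (ctx_ext H A).
Proof.
move=> /ctx_image_shift hGH z B; split.
  case/in_ctx_ext=> [[-> ->]|/hGH[x <- xG]].
    by exists None => //; apply/in_ctx_ext; left.
  by exists x => //; apply/in_ctx_ext; right.
case=> x <- /in_ctx_ext[[-> ->]|xG]; apply/in_ctx_ext; first by left.
by right; apply/hGH; exists x.
Qed.

Lemma ctx_inj_shift (S : theory) (V W : Type) (h : V -> W) (G : ctx S V) :
  ctx_inj h G -> ctx_inj (omap h) (ctx_shift G).
Proof.
move=> hG x y A B /in_ctx_shift[x' -> xG] /in_ctx_shift[y' -> yG] [].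
by move/(hG _ _ _ _ xG yG) ->.
Qed.

(** [omap h] keeps the bound variable [None] apart from the shifted names, which all have the form
    [Some _]. *)
Lemma ctx_inj_ext (S : theory) (V W : Type) (h : V -> W) (G : ctx S V) A :
  ctx_inj h G -> ctx_inj (omap h) (ctx_ext G A).
Proof.
move=> hG x y B C /in_ctx_ext[[-> _]|xG] /in_ctx_ext[[-> _]|yG] //.
- by case/in_ctx_shift: yG => ? ->.
- by case/in_ctx_shift: xG => ? ->.
- exact: (ctx_inj_shift hG) xG yG.
Qed.

(** * Typed terms under renaming *)

Lemma has_type_map (S : theory) (V W : Type) (h : V -> W) (G : ctx S V) H t A :
  ctx_image h G H -> has_type G t A -> has_type H (tm_map h t) A.
Proof.
move=> hGH tA; elim: tA W h H hGH => {V G t A} /=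
  [V G x A xG|V G f t _ IHt|V G|V G t u A B _ IHt _ IHu|V G t A B _ IHt
  |V G t A B _ IHt|V G t u A B _ IHt _ IHu|V G t A B _ IHt] W h H hGH.
- by apply: HVar; apply/hGH; exists x.
- by apply: HFun; apply: IHt.
- exact: HBang.
- by apply: HPair; [apply: IHt|apply: IHu].
- by apply: HFst; apply: IHt.
- by apply: HSnd; apply: IHt.
- by apply: HApp; [apply: IHt|apply: IHu].
- by apply: HLam; apply: IHt; apply: ctx_image_ext.
Qed.

(** The surjective half for terms: every variable has a preimage declared at the same type, so the
    typing derivation is copied rule by rule. *)
Lemma has_type_lift (S : theory) (V W : Type) (h : V -> W) (G : ctx S V) H t A :
  ctx_image h G H -> has_type H t A ->
  exists2 u, tm_map h u = t & has_type G u A.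
Proof.
move=> hGH tA; elim: tA V h G hGH => {W H t A} /=
  [W H x A xH|W H f t _ IHt|W H|W H t u A B _ IHt _ IHu|W H t A B _ IHt
  |W H t A B _ IHt|W H t u A B _ IHt _ IHu|W H t A B _ IHt] V h G hGH.
- by have /hGH[y <- yG] := xH; exists (TmVar y) => //; apply: HVar.
- by have [t' <- tA] := IHt _ _ _ hGH; exists (TmFun f t') => //; apply: HFun.
- by exists TmBang => //; apply: HBang.
- have [t' <- tA] := IHt _ _ _ hGH; have [u' <- uB] := IHu _ _ _ hGH.
  by exists (TmPair t' u') => //; apply: HPair.
- have [t' <- tA] := IHt _ _ _ hGH.
  by exists (TmFst t') => //; apply: HFst tA.
- have [t' <- tA] := IHt _ _ _ hGH.
  by exists (TmSnd t') => //; apply: HSnd tA.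
- have [t' <- tA] := IHt _ _ _ hGH; have [u' <- uB] := IHu _ _ _ hGH.
  by exists (TmApp t' u') => //; apply: HApp tA uB.
- have [t' <- tB] := IHt _ _ _ (ctx_image_ext A hGH).
  by exists (TmLam A t') => //; apply: HLam.
Qed.

(** The types [A] and [B] are independent for the sake of the induction: equal images of projections
    or applications do not reveal that the hidden types of their subterms agree. *)
Lemma tm_map_inj (S : theory) (V W : Type) (h : V -> W) (G : ctx S V) t u A B :
  ctx_inj h G -> has_type G t A -> has_type G u B ->
  tm_map h t = tm_map h u -> t = u.
Proof.
move=> hG tA; elim: tA W h u B hG => {V G t A} /=
  [V G x A xG|V G f t _ IHt|V G|V G t u A B _ IHt _ IHu|V G t A B _ IHt
  |V G t A B _ IHt|V G t u A B _ IHt _ IHu|V G t A B _ IHt] W h w C hG;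
  (* Inverting the second typing leaves only the pairs with equal head constructors. *)
  case=> {w C} //=.
- by move=> y B yG [/(hG _ _ _ _ xG yG) ->].
- by move=> g v vA [-> /(IHt _ _ _ _ hG vA) ->].
- by move=> v w A' B' vA wB [/(IHt _ _ _ _ hG vA) -> /(IHu _ _ _ _ hG wB) ->].
- by move=> v A' B' vA [/(IHt _ _ _ _ hG vA) ->].
- by move=> v A' B' vA [/(IHt _ _ _ _ hG vA) ->].
- by move=> v w A' B' vA wB [/(IHt _ _ _ _ hG vA) -> /(IHu _ _ _ _ hG wB) ->].
(* The binder annotations are identified first, so that both bodies are typed in the same extended
   context. *)
- move=> v A' B' vB [eA]; rewrite -{}eA in vB *.
  by move/(IHt _ _ _ _ (ctx_inj_ext (A := A) hG) vB) ->.
Qed.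

(** * Polarized contexts: swapping and extension *)

Definition pctx_image (S : theory) (V W : Type) (h : V -> W)
    (C : pctx S V) (D : pctx S W) : Prop :=
  ctx_image h (negc C ++ dinc C) (negc D ++ dinc D) /\
  ctx_image h (posc C ++ dinc C) (posc D ++ dinc D).

Definition pctx_inj (S : theory) (V W : Type) (h : V -> W) (C : pctx S V) : Prop :=
  ctx_inj h (negc C ++ dinc C) /\ ctx_inj h (posc C ++ dinc C).

Lemma pctx_image_swap (S : theory) (V W : Type) (h : V -> W) (C : pctx S V) D :
  pctx_image h C D -> pctx_image h (pctx_swap C) (pctx_swap D).
Proof. by case. Qed.

Lemma pctx_inj_swap (S : theory) (V W : Type) (h : V -> W) (C : pctx S V) :
  pctx_inj h C -> pctx_inj h (pctx_swap C).
Proof. by case. Qed.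

(** The new variable sits in the middle of one list and at the end of the other, so the comparison
    is by membership instead of equality. *)
Lemma in_ext_cat (S : theory) (V : Type) (G H : ctx S V) A z :
  List.In z (ctx_ext G A ++ ctx_shift H) <-> List.In z (ctx_ext (G ++ H) A).
Proof.
case: z => z B; rewrite List.in_app_iff !in_ctx_ext /ctx_shift map_cat.
by rewrite List.in_app_iff; tauto.
Qed.

Lemma shift_cat_ext (S : theory) (V : Type) (G H : ctx S V) A :
  ctx_shift G ++ ctx_ext H A = ctx_ext (G ++ H) A.
Proof. by rewrite /ctx_ext /ctx_shift map_cat rcons_cat. Qed.

Lemma shift_cat (S : theory) (V : Type) (G H : ctx S V) :
  ctx_shift G ++ ctx_shift H = ctx_shift (G ++ H).
Proof. by rewrite /ctx_shift map_cat. Qed.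

Lemma eq_ctx_image (S : theory) (V W : Type) (h : V -> W) (G G' : ctx S V) H H' :
  (forall z, List.In z G <-> List.In z G') ->
  (forall z, List.In z H <-> List.In z H') ->
  ctx_image h G' H' -> ctx_image h G H.
Proof.
move=> eG eH hGH y A; rewrite eH hGH.
by split=> -[x hx /eG xG]; exists x.
Qed.

Lemma eq_ctx_inj (S : theory) (V W : Type) (h : V -> W) (G G' : ctx S V) :
  (forall z, List.In z G <-> List.In z G') -> ctx_inj h G' -> ctx_inj h G.
Proof. by move=> eG hG x y A B /eG xG /eG; apply: hG xG. Qed.

Lemma pctx_image_ext (S : theory) (V W : Type) (h : V -> W) (C : pctx S V) D p A :
  pctx_image h C D -> pctx_image (omap h) (pctx_ext C p A) (pctx_ext D p A).
Proof.
case: C D => [Th De Ga] [Th' De' Ga'] [/= hn hp].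
case: p; split=> /=; rewrite ?shift_cat ?shift_cat_ext;
  try exact: ctx_image_shift; try exact: ctx_image_ext.
(* Two cases remain, where the new variable precedes the dinatural part: a negative one on the left
   and a positive one on the right. *)
- by apply: eq_ctx_image (ctx_image_ext A hn); apply: in_ext_cat.
- by apply: eq_ctx_image (ctx_image_ext A hp); apply: in_ext_cat.
Qed.

Lemma pctx_inj_ext (S : theory) (V W : Type) (h : V -> W) (C : pctx S V) p A :
  pctx_inj h C -> pctx_inj (omap h) (pctx_ext C p A).
Proof.
case: C => [Th De Ga] [/= hn hp].
case: p; split=> /=; rewrite ?shift_cat ?shift_cat_ext;
  try exact: ctx_inj_shift; try exact: ctx_inj_ext.
- by apply: eq_ctx_inj (ctx_inj_ext (A := A) hn); apply: in_ext_cat.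
- by apply: eq_ctx_inj (ctx_inj_ext (A := A) hp); apply: in_ext_cat.
Qed.

(** * Formulas under renaming *)

Lemma is_prop_map (S : theory) (V W : Type) (h : V -> W) (C : pctx S V) D phi :
  pctx_image h C D -> is_prop C phi -> is_prop D (fm_map h phi).
Proof.
move=> hCD Cphi; elim: Cphi W h D hCD => {V C phi} /=
  [V C|V C psi phi _ IH1 _ IH2|V C psi phi _ IH1 _ IH2|V C A s t sA tA
  |V C P s t sA tA|V C p A phi _ IH|V C p A phi _ IH] W h D hCD.
- exact: PTop.
- by apply: PAnd; [apply: IH1|apply: IH2].
- by apply: PImp; [apply: IH1; apply: pctx_image_swap|apply: IH2].
- by case: hCD => hn hp; apply: PLe; [apply: has_type_map sA|apply: has_type_map tA].
- by case: hCD => hn hp; apply: PPred; [apply: has_type_map sA|apply: has_type_map tA].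
- by apply: PEx; apply: IH; apply: pctx_image_ext.
- by apply: PAll; apply: IH; apply: pctx_image_ext.
Qed.

(** The two sides of an atom are lifted independently, so a name occurring on both sides may receive
    different preimages; this is what splits a dinatural variable into its two copies. *)
Lemma is_prop_lift (S : theory) (V W : Type) (h : V -> W) (C : pctx S V) D phi :
  pctx_image h C D -> is_prop D phi ->
  exists2 psi, is_prop C psi & fm_map h psi = phi.
Proof.
move=> hCD Dphi; elim: Dphi V h C hCD => {W D phi} /=
  [W D|W D psi phi _ IH1 _ IH2|W D psi phi _ IH1 _ IH2|W D A s t sA tA
  |W D P s t sA tA|W D p A phi _ IH|W D p A phi _ IH] V h C hCD.
- by exists FmTop => //; apply: PTop.
- have [a Ca <-] := IH1 _ _ _ hCD; have [b Cb <-] := IH2 _ _ _ hCD.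
  by exists (FmAnd a b) => //; apply: PAnd.
- have [a Ca <-] := IH1 _ _ _ (pctx_image_swap hCD).
  have [b Cb <-] := IH2 _ _ _ hCD.
  by exists (FmImp a b) => //; apply: PImp.
- case: hCD => hn hp.
  have [s' <- ?] := has_type_lift hn sA; have [t' <- ?] := has_type_lift hp tA.
  by exists (FmLe A s' t') => //; apply: PLe.
- case: hCD => hn hp.
  have [s' <- ?] := has_type_lift hn sA; have [t' <- ?] := has_type_lift hp tA.
  by exists (FmPred P s' t') => //; apply: PPred.
- have [a Ca <-] := IH _ _ _ (pctx_image_ext p A hCD).
  by exists (FmEx p A a) => //; apply: PEx.
- have [a Ca <-] := IH _ _ _ (pctx_image_ext p A hCD).
  by exists (FmAll p A a) => //; apply: PAll.
Qed.

(** Atoms are compared side by side, each side within its own list, so a left name is never compared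
    with a right name. *)
Lemma fm_map_inj (S : theory) (V W : Type) (h : V -> W) (C : pctx S V) phi psi :
  pctx_inj h C -> is_prop C phi -> is_prop C psi ->
  fm_map h phi = fm_map h psi -> phi = psi.
Proof.
move=> hC Cphi; elim: Cphi W h psi hC => {V C phi} /=
  [V C|V C a b _ IH1 _ IH2|V C a b _ IH1 _ IH2|V C A s t sA tA
  |V C P s t sA tA|V C p A a _ IH|V C p A a _ IH] W h w hC;
  case=> {w} //=.
- by move=> a' b' Ca Cb [/(IH1 _ _ _ hC Ca) -> /(IH2 _ _ _ hC Cb) ->].
- move=> a' b' Ca Cb [/(IH1 _ _ _ (pctx_inj_swap hC) Ca) ->].
  by move/(IH2 _ _ _ hC Cb) ->.
- case: hC => hn hp A' s' t' sA' tA' [->].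
  by move=> /(tm_map_inj hn sA sA') -> /(tm_map_inj hp tA tA') ->.
- case: hC => hn hp P' s' t' sA' tA' [->].
  by move=> /(tm_map_inj hn sA sA') -> /(tm_map_inj hp tA tA') ->.
- move=> p' A' a' Ca [ep eA]; rewrite -{}ep -{}eA in Ca *.
  by move/(IH _ _ _ (pctx_inj_ext p A hC) Ca) ->.
- move=> p' A' a' Ca [ep eA]; rewrite -{}ep -{}eA in Ca *.
  by move/(IH _ _ _ (pctx_inj_ext p A hC) Ca) ->.
Qed.

Lemma fm_map_bij (S : theory) (V W : Type) (h : V -> W) (C : pctx S V) D :
  pctx_image h C D -> pctx_inj h C ->
  set_bij (formulas C) (formulas D) (fm_map h).
Proof.
move=> hCD hC; split.
- by move=> phi; apply: is_prop_map.
- by move=> phi psi /set_mem Cphi /set_mem Cpsi; apply: fm_map_inj hC Cphi Cpsi.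
- by move=> phi /(is_prop_lift hCD).
Qed.

Lemma omap_id (T : Type) : omap (@id T) = id.
Proof. by apply/funext => -[]. Qed.

Lemma tm_map_id (S : theory) (V : Type) (t : tm S V) : tm_map id t = t.
Proof.
by elim: t => {V} //= *; rewrite ?omap_id; congruence.
Qed.

Lemma fm_map_id (S : theory) (V : Type) (phi : fm S V) : fm_map id phi = phi.
Proof.
by elim: phi => {V} //= *; rewrite ?omap_id ?tm_map_id; congruence.
Qed.

(** * The collapse as a renaming *)

Lemma mem_names (S : theory) (V : eqType) (G : ctx S V) x A :
  List.In (x, A) G -> x \in names G.
Proof.
elim: G => [|[y B] G IH] //= [[-> _]|/IH xG]; first exact: mem_head.
by rewrite inE xG orbT.
Qed.

(** One branch of [collapse_name], isolated to treat both copies alike. For lists of equal length,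
    the default [x] is not reached at names of [D]. *)
Definition rename_along (S : theory) (V : eqType) (D De : ctx S V) (x : V) : V :=
  nth x (names De) (index x (names D)).

Lemma ctx_image_rename_along (S : theory) (V : eqType) (D De : ctx S V) :
  unzip2 D = unzip2 De -> uniq (names D) -> ctx_image (rename_along D De) D De.
Proof.
rewrite /ctx_image /rename_along.
elim: D De => [|[x A] D IH] [|[y B] De] //=; first by split=> // -[].
case=> <- /IH{}IH /andP[xD /IH{}IH] z C; split.
  case=> [[<- <-]|/IH[x' <- x'D]]; first by exists x; [rewrite eqxx|left].
  exists x'; last by right.
  (* A tail name equal to the head name would contradict the distinctness of the names of [D]. *)
  by case: eqP => // exx'; rewrite exx' (mem_names x'D) in xD.
case=> x' + [[exx' ->]|x'D]; first by rewrite exx' eqxx /= => ->; left.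
case: eqP => [exx'|_ /= hx']; first by rewrite exx' (mem_names x'D) in xD.
by right; apply/IH; exists x'.
Qed.

Lemma rename_along_inj (S : theory) (V : eqType) (D De : ctx S V) :
  unzip2 D = unzip2 De -> uniq (names De) ->
  {in names D &, injective (rename_along D De)}.
Proof.
move=> eD uDe x y xD yD.
have sz : size (names D) = size (names De).
  by rewrite /names !size_map -(size_map snd D) -(size_map snd De); congr size.
(* Both lookups get the same default, so distinctness of the names of [De] turns equal values into
   equal positions. *)
rewrite /rename_along (set_nth_default y) -?sz ?index_mem // => /eqP.
rewrite nth_uniq -?sz ?index_mem // => /eqP eqi.
by rewrite -(nth_index x xD) eqi nth_index.
Qed.

Lemma ctx_image_copy (S : theory) (V : eqType) (h : V -> V) (G D De : ctx S V) :
  unzip2 D = unzip2 De -> uniq (names D) ->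
  {in names G, h =1 id} -> {in names D, h =1 rename_along D De} ->
  ctx_image h (G ++ D) (G ++ De).
Proof.
move=> eD uD hG hD y A; rewrite List.in_app_iff; split.
  case=> [yG|/(ctx_image_rename_along eD uD)[x <- xD]].
    by exists y; [apply: hG; apply: mem_names yG|apply: List.in_or_app; left].
  by exists x; [apply: hD; apply: mem_names xD|apply: List.in_or_app; right].
case=> x <- /(@List.in_app_or _ _ _ _)[xG|xD].
  by left; rewrite hG // (mem_names xG).
rewrite hD ?(mem_names xD) //; right.
by apply/(ctx_image_rename_along eD uD); exists x.
Qed.

(** The mixed case is the critical one: a name of [D] lands in [De], whose names are disjoint from
    those of [G], where [h] is the identity. *)
Lemma ctx_inj_copy (S : theory) (V : eqType) (h : V -> V) (G D De : ctx S V) :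
  unzip2 D = unzip2 De -> uniq (names D) -> uniq (names (G ++ De)) ->
  {in names G, h =1 id} -> {in names D, h =1 rename_along D De} ->
  ctx_inj h (G ++ D).
Proof.
move=> eD uD; rewrite /names /unzip1 map_cat cat_uniq => /and3P[_ dis uDe] hG hD.
have GD x y A B : List.In (x, A) G -> List.In (y, B) D -> h x <> h y.
  move=> xG yD; have := mem_names yD; have := mem_names xG => xnG ynD.
  rewrite hG // hD // => exy; case/hasP: dis; exists x => //.
  apply: (@mem_names _ _ De x B); rewrite exy.
  by apply/(ctx_image_rename_along eD uD); exists y.
move=> x y A B /(@List.in_app_or _ _ _ _)[] xI /(@List.in_app_or _ _ _ _)[] yI.
- by rewrite !hG ?(mem_names xI) ?(mem_names yI).
- by move/(GD _ _ _ _ xI yI).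
- by move/esym/(GD _ _ _ _ yI xI).
- have [xD yD] := (mem_names xI, mem_names yI).
  by rewrite !hD //; apply: (rename_along_inj eD uDe).
Qed.

Lemma collapse_name_id (S : theory) (V : eqType) (De : ctx S V) :
  collapse_name De De De = id.
Proof.
by apply/funext => x; rewrite /collapse_name; case: ifP => [/nth_index ->|->].
Qed.

Theorem mainTheorem2 (S : theory) (V : eqType) (Th De Ga : ctx S V)
    (wfC : wf_pctx [ctx Th | De | Ga]) :
  (forall D1 D2 : ctx S V, fresh_copies Th De Ga D1 D2 ->
     set_bij (formulas [ctx Th ++ D1 | [::] | Ga ++ D2])
             (formulas [ctx Th | De | Ga])
             (collapse D1 D2 De)) /\
  (exists g : fm S V -> fm S V,
     set_bij (formulas [ctx Th | De | Ga])
             (formulas [ctx Th ++ De | [::] | Ga ++ De]) g /\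
     (forall phi : fm S V, formulas [ctx Th ++ De | [::] | Ga ++ De] phi ->
        g (collapse De De De phi) = phi)).
Proof.
case/andP: (wfC) => /= uTh uGa; split.
  move=> D1 D2 [e1 e2]; rewrite cat_uniq => /and3P[u1 dis u2] /hasPn fresh.
  (* Freshness keeps the original names out of both branches of [collapse_name]. *)
  have fixed G : {subset names G <= names Th ++ names De ++ names Ga} ->
      {in names G, collapse_name D1 D2 De =1 id}.
    move=> sG x /sG xG; rewrite /collapse_name.
    case: ifPn => [xD|_]; last case: ifPn => [xD|//].
      by have /fresh/negP[] : x \in names D1 ++ names D2 by rewrite mem_cat xD.
    by have /fresh/negP[] : x \in names D1 ++ names D2
      by rewrite mem_cat xD orbT.
  have fTh : {in names Th, collapse_name D1 D2 De =1 id}.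
    by apply: fixed => x xTh; rewrite mem_cat xTh.
  have fGa : {in names Ga, collapse_name D1 D2 De =1 id}.
    by apply: fixed => x xGa; rewrite !mem_cat xGa !orbT.
  have h1 : {in names D1, collapse_name D1 D2 De =1 rename_along D1 De}.
    by move=> x xD; rewrite /collapse_name xD.
  have h2 : {in names D2, collapse_name D1 D2 De =1 rename_along D2 De}.
    (* [collapse_name] tests [D1] first; disjointness of the two copies selects the second
       branch. *)
    move=> x xD; rewrite /collapse_name xD ifN //.
    by apply: contra dis => xD1; apply/hasP; exists x.
  apply: fm_map_bij; split; rewrite /= cats0.
  - exact: ctx_image_copy.
  - exact: ctx_image_copy.
  - exact: ctx_inj_copy h1.
  - exact: ctx_inj_copy h2.
(* Moving [De] out of the dinatural slot leaves both visible lists unchanged, and collapsing [De]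
   onto itself is the identity. *)
exists (fm_map id); split; last first.
  by move=> phi _; rewrite /collapse collapse_name_id !fm_map_id.
apply: fm_map_bij; split=> //= y A; rewrite cats0.
- by split=> [yI|[_ <-]//]; exists y.
- by split=> [yI|[_ <-]//]; exists y.
Qed.
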